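(* Let $M_-,M_+\in\mathbb{Z}$ with $M:=M_-+M_+\geq2$, and let $K_{\rm s}\in\{1,\dots,M-1\}$. The rational functions $\sigma_{R_1,M_-,M_+,K_{\rm s},k_{\rm s}}$, $k_{\rm s}\in\{0,\dots,K_{\rm s}\}$, which represent the Lagrange reconstructing polynomial as a combination of those on the $K_{\rm s}$-level substencils are unique: if $s_0,\dots,s_{K_{\rm s}}$ are rational functions such that $$p_{R_1,M_-,M_+}(x_i+\xi\Delta x;x_i,\Delta x;f)=\sum_{k_{\rm s}=0}^{K_{\rm s}}s_{k_{\rm s}}(\xi)\;p_{R_1,M_--k_{\rm s},M_+-K_{\rm s}+k_{\rm s}}(x_i+\xi\Delta x;x_i,\Delta x;f)$$ for all $\xi\in\mathbb{R}\setminus\mathcal{S}_{R_1,M_-,M_+,K_{\rm s}}$ at which all $s_{k_{\rm s}}$ are defined, all $x_i\in\mathbb{R}$, all $\Delta x>0$ and all $f:\mathbb{R}\to\mathbb{R}$, then $s_{k_{\rm s}}=\sigma_{R_1,M_-,M_+,K_{\rm s},k_{\rm s}}$ for every $k_{\rm s}\in\{0,\dots,K_{\rm s}\}$.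
   Context: For integers $N_\pm$ (of either sign) with $N:=N_-+N_+\ge0$ and $\ell\in\{-N_-,\dots,N_+\}$, put $$\alpha_{I,N_-,N_+,\ell}(\xi)=\prod_{k=-N_-,\,k\neq\ell}^{N_+}\frac{\xi-k}{\ell-k}=\sum_{m=0}^{N}a^{N_-,N_+}_{m,\ell}\,\xi^m ,$$ which defines the coefficients $a^{N_-,N_+}_{m,\ell}$. The fundamental polynomials of Lagrange reconstruction are $$\alpha_{R_1,N_-,N_+,\ell}(\xi):=\sum_{m=0}^{N}\Bigl(\sum_{k=0}^{\lfloor (N-m)/2\rfloor}\frac{\tau_{2k}\,(m+2k)!}{m!}\,a^{N_-,N_+}_{m+2k,\ell}\Bigr)\xi^m ,$$ where $\tau_0=1$ and $\tau_{2k}=-\sum_{s=0}^{k-1}\dfrac{\tau_{2s}}{2^{2k-2s}(2k-2s+1)!}$ for $k\geq1$. The Lagrange reconstructing polynomial of $f:\mathbb{R}\to\mathbb{R}$ on the equidistant points $x_i+\ell\Delta x$, $\ell\in\{-N_-,\dots,N_+\}$, is $$p_{R_1,N_-,N_+}(x_i+\xi\Delta x;x_i,\Delta x;f)=\sum_{\ell=-N_-}^{N_+}\alpha_{R_1,N_-,N_+,\ell}(\xi)\,f(x_i+\ell\Delta x);$$ it is the unique polynomial of $x=x_i+\xi\Delta x$ whose sliding averages $\frac1{\Delta x}\int_{x-\Delta x/2}^{x+\Delta x/2}p_{R_1,N_-,N_+}(\zeta)\,d\zeta$ equal, for all $x$, the Lagrange interpolating polynomial of $f$ on these points. The weight-functions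 are the rational functions defined recursively, for $k_{\rm s}\in\{0,\dots,K_{\rm s}\}$, by $$\sigma_{R_1,M_-,M_+,1,k_{\rm s}}(\xi)=\dfrac{\alpha_{R_1,M_-,M_+,-M_-+k_{\rm s}M}(\xi)}{\alpha_{R_1,M_--k_{\rm s},M_+-1+k_{\rm s},-M_-+k_{\rm s}M}(\xi)},$$ and, for $K_{\rm s}\geq2$, $$\sigma_{R_1,M_-,M_+,K_{\rm s},k_{\rm s}}(\xi)=\sum_{\ell_{\rm s}=\max(0,k_{\rm s}-1)}^{\min(K_{\rm s}-1,k_{\rm s})}\sigma_{R_1,M_-,M_+,K_{\rm s}-1,\ell_{\rm s}}(\xi)\;\sigma_{R_1,M_--\ell_{\rm s},M_+-(K_{\rm s}-1)+\ell_{\rm s},1,k_{\rm s}-\ell_{\rm s}}(\xi).$$ They satisfy the displayed representation (with $s_{k_{\rm s}}=\sigma_{R_1,M_-,M_+,K_{\rm s},k_{\rm s}}$) outside the finite set $\mathcal{S}_{R_1,M_-,M_+,K_{\rm s}}\subset\mathbb{R}$ of their poles (for $K_{\rm s}=1$, $\mathcal{S}_{R_1,M_-,M_+,1}:=\{\xi\in\mathbb{R}:\alpha_{R_1,M_--1,M_+,M_+}(\xi)=0\}$). *)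

(* Defs.v *)
From HB Require Import structures.
From mathcomp Require Import all_boot all_order all_algebra.
From mathcomp Require Import reals.

Set Implicit Arguments.
Unset Strict Implicit.
Unset Printing Implicit Defensive.

Import Order.TTheory GRing.Theory Num.Theory.

Local Open Scope ring_scope.

Notation "p %:F" := (tofrac p) : ring_scope.

Section RationalFunctions.
Variable F : fieldType.
Implicit Types (p q : {poly F}) (s : {fraction {poly F}}) (x : F).

(* [repr s] need not be in lowest terms; dividing by the gcd makes the
   removable singularities of the representative disappear. *)
Definition rf_num s : {poly F} :=
  let r := repr s in \n_r %/ gcdp \n_r \d_r.
Definition rf_den s : {poly F} :=
  let r := repr s in \d_r %/ gcdp \n_r \d_r.

Definition rf_defined s x : bool := ~~ root (rf_den s) x.

(* Meaningful only where [rf_defined s x]. *)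
Definition rf_eval s x : F := (rf_num s).[x] / (rf_den s).[x].

Lemma rf_gcd_neq0 s : gcdp \n_(repr s) \d_(repr s) != 0.
Proof. by rewrite gcdp_eq0 negb_and denom_ratioP orbT. Qed.

Lemma rf_den_neq0 s : rf_den s != 0.
Proof.
by rewrite /rf_den dvdp_div_eq0 ?dvdp_gcdr ?denom_ratioP.
Qed.

Lemma rf_coprime s : coprimep (rf_num s) (rf_den s).
Proof.
have h : (\n_(repr s) != 0) || (\d_(repr s) != 0).
  by rewrite denom_ratioP orbT.
exact: coprimep_div_gcd.
Qed.

Lemma rf_numden s : s = (rf_num s)%:F / (rf_den s)%:F.
Proof.
have dF : (rf_den s)%:F != 0 by rewrite tofrac_eq0 rf_den_neq0.
have gF : (gcdp \n_(repr s) \d_(repr s))%:F != 0.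
  by rewrite tofrac_eq0 rf_gcd_neq0.
have es : s = (\n_(repr s))%:F / (\d_(repr s))%:F.
  apply: (canRL (mulfK _)); first by rewrite tofrac_eq0 denom_ratioP.
  rewrite -{1}[s]reprK; unlock tofrac; rewrite -[LHS]FracField.pi_mul.
  apply/eqP; rewrite FracField.equivf_def /FracField.mulf.
  rewrite !numden_Ratio ?oner_eq0 ?mulf_neq0 ?oner_eq0 ?denom_ratioP //.
  by rewrite !mulr1 mulrC.
have en : \n_(repr s) = rf_num s * gcdp \n_(repr s) \d_(repr s).
  by rewrite divpK ?dvdp_gcdl.
have ed : \d_(repr s) = rf_den s * gcdp \n_(repr s) \d_(repr s).
  by rewrite divpK ?dvdp_gcdr.
move: en ed gF es; set g := gcdp _ _ => en ed gF es.
by rewrite [LHS]es en ed !tofracM invfM mulrACA (divff gF) mulr1.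
Qed.

Lemma rf_cross p q s : q != 0 -> s = p%:F / q%:F ->
  rf_num s * q = p * rf_den s.
Proof.
move=> q0 es; have := rf_numden s; rewrite {1}es => /eqP.
rewrite eqr_div ?tofrac_eq0 ?rf_den_neq0 // -!tofracM tofrac_eq => /eqP ->.
by [].
Qed.

Lemma rf_definedP s x :
  reflect (exists p q, q.[x] != 0 /\ s = p%:F / q%:F) (rf_defined s x).
Proof.
apply: (iffP idP) => [h|[p [q [qx es]]]].
  by exists (rf_num s), (rf_den s); split; [exact: h | exact: rf_numden].
have q0 : q != 0 by apply: contraNneq qx => ->; rewrite horner0.
have dq : rf_den s %| q.
  have := dvdp_mull p (dvdpp (rf_den s)).
  rewrite -(rf_cross q0 es) Gauss_dvdpr // coprimep_sym.
  exact: rf_coprime.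
by apply: contra qx => rx; exact: (root_dvdp dq).
Qed.

Lemma rf_evalE p q x : q.[x] != 0 -> rf_eval (p%:F / q%:F) x = p.[x] / q.[x].
Proof.
move=> qx; have q0 : q != 0 by apply: contraNneq qx => ->; rewrite horner0.
have dx : rf_defined (p%:F / q%:F) x by apply/rf_definedP; exists p, q.
apply/eqP; rewrite /rf_eval eqr_div // -!hornerM.
by rewrite (rf_cross q0 erefl).
Qed.

End RationalFunctions.

Section Reconstruction.
Variable R : realType.
Implicit Types (Nm Np Mm Mp l : int) (k K : nat) (x x_i dx : R) (f : R -> R).

(* The points -Nm, ..., Np; only used for Nm + Np >= 0. *)
Definition stencil Nm Np : seq int :=
  [seq i%:Z - Nm | i <- iota 0 (absz (Nm + Np)).+1].

Definition alphaI Nm Np l : {poly R} :=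
  \prod_(k <- stencil Nm Np | k != l) ((l - k)%:~R^-1 *: ('X - k%:~R%:P)).

Fixpoint tau_seq k : seq R :=
  if k is k'.+1 then
    let t := tau_seq k' in
    rcons t (- \sum_(s < k) t`_s / (2 ^+ (2 * k - 2 * s)
                                    * (2 * k - 2 * s + 1)`!%:R))
  else [:: 1].

(* [tau2 k] is tau_{2k}; see [tau2_rec] for the defining recursion. *)
Definition tau2 k : R := (tau_seq k)`_k.

Lemma size_tau_seq k : size (tau_seq k) = k.+1.
Proof. by elim: k => //= k IH; rewrite size_rcons IH. Qed.

Lemma nth_tau_seq k s : (s <= k)%N -> (tau_seq k)`_s = tau2 s.
Proof.
elim: k => [|k IH]; first by rewrite leqn0 => /eqP ->.
rewrite leq_eqVlt => /orP[/eqP -> //|]; rewrite ltnS => sk.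
by rewrite /= nth_rcons size_tau_seq ltnS sk IH.
Qed.

Lemma tau2_0 : tau2 0 = 1.
Proof. by []. Qed.

Lemma tau2_rec k : (0 < k)%N ->
  tau2 k = - \sum_(s < k) tau2 s / (2 ^+ (2 * k - 2 * s)
                                    * (2 * k - 2 * s + 1)`!%:R).
Proof.
case: k => // k _; rewrite {1}/tau2 /= nth_rcons size_tau_seq ltnn eqxx.
by congr (- _); apply: eq_bigr => s _; rewrite nth_tau_seq // -ltnS.
Qed.

Definition alphaR1 Nm Np l : {poly R} :=
  let N := absz (Nm + Np) in
  \poly_(m < N.+1)
    \sum_(k < ((N - m)./2).+1)
      (tau2 k * (m + 2 * k)`!%:R / m`!%:R * (alphaI Nm Np l)`_(m + 2 * k)%N).

(* The value at [x] of the Lagrange reconstructing polynomial of [f] on the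
   points [x_i + l * dx], [l \in stencil Nm Np]. *)
Definition pR1 Nm Np x x_i dx f : R :=
  \sum_(l <- stencil Nm Np)
    (alphaR1 Nm Np l).[(x - x_i) / dx] * f (x_i + l%:~R * dx).

Definition sigmaR1_1 Mm Mp k : {fraction {poly R}} :=
  let l := - Mm + k%:Z * (Mm + Mp) in
  (alphaR1 Mm Mp l)%:F / (alphaR1 (Mm - k%:Z) (Mp - 1 + k%:Z) l)%:F.

(* [k.-1] is truncated, hence equal to max(0, k - 1); the value at [K = 0] is
   irrelevant. *)
Fixpoint sigmaR1 Mm Mp K k : {fraction {poly R}} :=
  match K with
  | 0 => 0
  | 1 => sigmaR1_1 Mm Mp k
  | K'.+1 =>
      \sum_(k.-1 <= l < (minn K' k).+1)
        sigmaR1 Mm Mp K' l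
        * sigmaR1_1 (Mm - l%:Z) (Mp - K'%:Z + l%:Z) (k - l)
  end.

Definition poleset Mm Mp K : pred R :=
  if K == 1%N then root (alphaR1 (Mm - 1) Mp Mp)
  else [pred x | [exists k : 'I_K.+1, ~~ rf_defined (sigmaR1 Mm Mp K k) x]].

End Reconstruction.

(* Main.v *)
(* Taking [f] to be the indicator of the point of index [l] turns the
   representation into one identity of rational functions per [l], valid because
   it holds at all but finitely many points.  The point [- Mm + k] lies outside
   every substencil of index [j > k], so these identities form a triangular
   system, whose diagonal entries are nonzero since reconstruction preserves
   leading coefficients; hence its solution is unique.  That the [sigmaR1] are
   a solution follows by induction on [K] from the case [K = 1].  There the
   interpolants on the two substencils differ from the full one by the same
   divided difference times the node polynomials of the substencils, and
   reconstruction is linear. *)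
Require Import Defs.
From HB Require Import structures.
From mathcomp Require Import all_boot all_order all_algebra.
From mathcomp Require Import reals.
From mathcomp Require Import ring zify.

Set Implicit Arguments.
Unset Strict Implicit.
Unset Printing Implicit Defensive.

Import Order.TTheory GRing.Theory Num.Theory.

Local Open Scope ring_scope.

(** * Identities in a field *)

Section FieldIdentities.
Variable F : fieldType.
Implicit Types a c w : F.

Lemma divf_mul2l c a w : c != 0 -> (c * a) / (c * w) = a / w.
Proof. by move=> c0; rewrite -mulf_div divff // mul1r. Qed.

(** The two weights sum to 1, and the combination of [w0] and [w1] with these weights is 0, so [c]
    cancels. *)
Lemma affine_combination a c w0 w1 : w0 - w1 != 0 ->
  a = w1 / (w1 - w0) * (a - c * w0) + w0 / (w0 - w1) * (a - c * w1).
Proof. by move=> w01; field; rewrite w01 -opprB oppr_eq0. Qed.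

End FieldIdentities.

(** * Lagrange interpolation on an arbitrary list of integer nodes *)

Section Lagrange.
Variable F : numFieldType.
Implicit Types (S : seq int) (a l : int).

Definition node S : {poly F} := \prod_(k <- S) ('X - k%:~R%:P).

(** For [l] in a duplicate-free [S], the coefficient of the value at [l] in the divided difference
    over [S]. *)
Definition lag_weight S l : F := \prod_(k <- S | k != l) (l - k)%:~R^-1.

Definition lag S l : {poly F} :=
  \prod_(k <- S | k != l) ((l - k)%:~R^-1 *: ('X - k%:~R%:P)).

(** Extension by zero makes this the coefficient of the value at [l] in the interpolant on [S] for
    every [l], so that interpolants on different node lists can be subtracted. *)
Definition lag_ext S l : {poly F} := if l \in S then lag S l else 0.

Lemma lag_weight_neq0 S l : lag_weight S l != 0.
Proof.
rewrite /lag_weight; elim/big_rec: _ => [|k x kl x0]; first exact: oner_neq0.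
by rewrite mulf_neq0 // invr_eq0 intr_eq0 subr_eq0 eq_sym.
Qed.

Lemma lag_notin S l : l \notin S -> lag S l = lag_weight S l *: node S.
Proof.
move=> lS; rewrite /lag /lag_weight /node scaler_prod; congr (_ *: _).
rewrite big_seq_cond [RHS]big_seq; apply: eq_bigl => k.
by case kS: (k \in S) => //=; apply: contraNneq lS => <-.
Qed.

Lemma lag_cons_in S a l : a != l ->
  lag (a :: S) l = ((l - a)%:~R^-1 *: ('X - a%:~R%:P)) * lag S l.
Proof. by move=> al; rewrite /lag big_cons al. Qed.

Lemma lag_mulX S l : uniq S -> l \in S ->
  lag S l * ('X - l%:~R%:P) = lag_weight S l *: node S.
Proof.
move=> uS lS; rewrite /lag /lag_weight /node scaler_prod [in RHS](bigD1_seq l) //=.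
by rewrite -scalerAl mulrC.
Qed.

Lemma lag_neq0 S l : lag S l != 0.
Proof.
rewrite /lag; elim/big_rec: _ => [|k x kl x0]; first exact: oner_neq0.
rewrite mulf_neq0 // scaler_eq0 negb_or polyXsubC_eq0 andbT.
by rewrite invr_eq0 intr_eq0 subr_eq0 eq_sym.
Qed.

Lemma size_lag S l : uniq S -> l \in S -> size (lag S l) = size S.
Proof.
move=> uS lS; have := congr1 (fun p : {poly F} => size p) (lag_mulX uS lS).
rewrite size_scale ?lag_weight_neq0 // size_Mmonic ?lag_neq0 ?monicXsubC //.
by rewrite size_XsubC addn2 /= /node size_prod_XsubC => -[].
Qed.

Lemma perm_lag_weight S S' l :
  perm_eq S S' -> lag_weight S l = lag_weight S' l.
Proof. exact: perm_big. Qed.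

Lemma perm_lag_ext S S' l : perm_eq S S' -> lag_ext S l = lag_ext S' l.
Proof.
by move=> p; rewrite /lag_ext (perm_mem p); case: ifP => // _; exact: perm_big.
Qed.

(* Newton's form: adding one node changes the interpolant by a divided
   difference times the node polynomial. *)
Lemma lag_ext_cons S a l : uniq (a :: S) -> l \in a :: S ->
  lag_ext (a :: S) l - lag_ext S l = lag_weight (a :: S) l *: node S.
Proof.
move=> /= /andP[aS uS]; rewrite /lag_ext => ll; rewrite ll.
(* If [l] is the added node, the old interpolant does not involve it, and [lag (a :: S) l] is
   already a multiple of the node polynomial. *)
have [la|al] := eqVneq a l.
  move: aS; rewrite la => lS.
  rewrite (negPf lS) subr0 /lag /lag_weight !big_cons !eqxx /=.
  exact: lag_notin.
have lS : l \in S by move: ll; rewrite inE eq_sym (negPf al).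
(* What remains is $(X - a)/(l - a) - 1 = (X - l)/(l - a)$, whose factor $X - l$ completes [lag S l]
   to the node polynomial. *)
rewrite lS lag_cons_in // /lag_weight big_cons al -scalerA -lag_mulX //.
have la0 : (l - a)%:~R != 0 :> F by rewrite intr_eq0 subr_eq0 eq_sym.
have la1 : ((l - a)%:~R^-1 * (l - a)%:~R : F)%:P = 1 by rewrite mulVf.
rewrite -!mul_polyC -[X in _ - X]mul1r -la1 polyCM intrB polyCB; ring.
Qed.

End Lagrange.

(** * Reconstruction as a linear differential operator *)

Section Reconstruct.
Variable R : realType.
Implicit Types (p q : {poly R}) (n : nat).

(* The inverse of the sliding average of width [1], truncated after [n] terms;
   exact on polynomials of degree less than [2 * n]. *)
Definition reconstruct n p : {poly R} := \sum_(k < n) tau2 R k *: p^`(2 * k).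

Lemma reconstruct0 n : reconstruct n 0 = 0.
Proof. by rewrite /reconstruct big1 // => k _; rewrite linear0 scaler0. Qed.

Lemma reconstructB n p q :
  reconstruct n (p - q) = reconstruct n p - reconstruct n q.
Proof.
rewrite /reconstruct -sumrB; apply: eq_bigr => k _.
by rewrite linearB scalerBr.
Qed.

Lemma reconstructZ n (c : R) p : reconstruct n (c *: p) = c *: reconstruct n p.
Proof.
rewrite /reconstruct scaler_sumr; apply: eq_bigr => k _.
by rewrite linearZ !scalerA mulrC.
Qed.

Lemma reconstruct_neq0 n p : p != 0 -> reconstruct n.+1 p != 0.
Proof.
(* The term $k = 0$ is [p] itself, and the others are derivatives of lower degree, so the leading
   coefficient survives. *)
move=> p0; have: (reconstruct n.+1 p)`_(size p).-1 != 0.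
  rewrite coef_sum big_ord_recl big1 => [|k _].
    by rewrite addr0 coefZ tau2_0 mul1r muln0 derivn0 lead_coef_eq0.
  rewrite coefZ coef_derivn nth_default ?mul0rn ?mulr0 //= /bump /=.
  have := size_poly_eq0 p; rewrite (negPf p0); case: (size p) => // s _ /=; lia.
by apply: contraNneq => ->; rewrite coef0.
Qed.

End Reconstruct.

(** * Equidistant stencils and their reconstruction polynomials *)

Section Stencil.
Variable R : realType.
Implicit Types (Nm Np l : int).

Lemma mem_stencil Nm Np l : 0 <= Nm + Np ->
  (l \in stencil Nm Np) = (- Nm <= l <= Np).
Proof.
move=> N0; apply/mapP/idP => [[i]|h].
  rewrite mem_iota => /andP[_ hi] ->; lia.
exists (absz (l + Nm)); last by lia.
by rewrite mem_iota; lia.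
Qed.

Lemma stencil_uniq Nm Np : uniq (stencil Nm Np).
Proof. by rewrite map_inj_uniq ?iota_uniq // => i j; lia. Qed.

Lemma stencil_addr Nm Np : 1 <= Nm + Np ->
  perm_eq (stencil Nm Np) (Np :: stencil Nm (Np - 1)).
Proof.
move=> N1; apply: uniq_perm => [||l]; first exact: stencil_uniq.
  by apply/andP; split; [rewrite mem_stencil; lia | exact: stencil_uniq].
by rewrite mem_stencil; [rewrite in_cons mem_stencil|]; lia.
Qed.

Lemma stencil_addl Nm Np : 1 <= Nm + Np ->
  perm_eq (stencil Nm Np) (- Nm :: stencil (Nm - 1) Np).
Proof.
move=> N1; apply: uniq_perm => [||l]; first exact: stencil_uniq.
  by apply/andP; split; [rewrite mem_stencil; lia | exact: stencil_uniq].
by rewrite mem_stencil; [rewrite in_cons mem_stencil|]; lia.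
Qed.

(** The point [- Nm] is a root of the first polynomial only. *)
Lemma node_stencil_neq Nm Np : 1 <= Nm + Np ->
  node R (stencil Nm (Np - 1)) != node R (stencil (Nm - 1) Np).
Proof.
move=> N1; have N0 : 0 <= Nm + (Np - 1) by lia.
have h : - Nm \in stencil Nm (Np - 1) by rewrite mem_stencil; lia.
have h' : - Nm \notin stencil (Nm - 1) Np by rewrite mem_stencil; lia.
apply: contraNneq h' => e.
have : root (node R (stencil Nm (Np - 1))) (- Nm)%:~R.
  by rewrite /node (big_rem _ h) /= rootM root_XsubC eqxx.
rewrite e /node -(big_map (fun k : int => k%:~R) predT (fun x => 'X - x%:P)).
by rewrite root_prod_XsubC mem_map //; exact: intr_inj.
Qed.

(** The quotient $(m+2k)!/m!$ is the falling factorial produced by the derivative of order $2k$, and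
    coefficients of index above $N$ vanish. Leaving [n] free lets stencils of different sizes share
    one operator. *)
Lemma alphaR1_reconstruct Nm Np l n : 0 <= Nm + Np ->
    l \in stencil Nm Np -> Nm + Np < n%:Z ->
  alphaR1 R Nm Np l = reconstruct n (lag R (stencil Nm Np) l).
Proof.
move=> N0 lS Nn; rewrite /alphaR1 -[alphaI R Nm Np l]/(lag R (stencil Nm Np) l).
have := @size_lag R _ _ (stencil_uniq Nm Np) lS.
move: (lag _ _ _) => p; rewrite size_map size_iota.
have {Nn} : (absz (Nm + Np)%R < n)%N by lia.
move: (absz _) => N Nn sp; apply/polyP => m.
rewrite coef_poly coef_sum.
under [RHS]eq_bigr do rewrite coefZ coef_derivn.
have [mN|mN] := ltnP; last first.
  rewrite big1 // => k _; rewrite nth_default ?mul0rn ?mulr0 // sp.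
  by apply: leq_trans mN (leq_addl _ _).
rewrite (big_ord_widen n (fun k => tau2 R k * (m + 2 * k)`!%:R / m`!%:R
                                    * p`_(m + 2 * k))); last by lia.
rewrite big_mkcond; apply: eq_bigr => k _; case: ifPn => kN.
  rewrite -mulrA -mulrA; congr (_ * _); rewrite -[RHS]mulr_natr.
  rewrite mulrA mulrC addnC; congr (_ * _).
  rewrite -(ffact_fact (leq_addr m (2 * k))) addKn natrM mulfK //.
  by rewrite pnatr_eq0 -lt0n fact_gt0.
by rewrite nth_default ?mul0rn ?mulr0 // sp; lia.
Qed.

Definition alphaR1_ext Nm Np l : {poly R} :=
  if l \in stencil Nm Np then alphaR1 R Nm Np l else 0.

Lemma alphaR1_extE Nm Np l n : 0 <= Nm + Np -> Nm + Np < n%:Z ->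
  alphaR1_ext Nm Np l = reconstruct n (lag_ext R (stencil Nm Np) l).
Proof.
rewrite /alphaR1_ext /lag_ext; case: ifP => lS N0 Nn.
  exact: alphaR1_reconstruct.
by rewrite reconstruct0.
Qed.

Lemma alphaR1_neq0 Nm Np l : 0 <= Nm + Np -> l \in stencil Nm Np ->
  alphaR1 R Nm Np l != 0.
Proof.
move=> N0 lS; rewrite (@alphaR1_reconstruct _ _ _ (absz (Nm + Np)%R).+1) //.
  by rewrite reconstruct_neq0 // lag_neq0.
by lia.
Qed.

(** The indicator isolates one coefficient. The form [0 + x * 1] is what the hypothesis of the
    theorem becomes for $x_i = 0$ and $\Delta x = 1$. *)
Lemma pR1_indicator Nm Np l (x : R) :
  pR1 Nm Np (0 + x * 1) 0 1 (fun y => (y == l%:~R)%:R)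
  = (alphaR1_ext Nm Np l).[x].
Proof.
rewrite /pR1 /alphaR1_ext add0r mulr1 subr0 divr1.
have eqb (k : int) : (0 + k%:~R * 1 == l%:~R :> R) = (k == l).
  by rewrite add0r mulr1 eqr_int.
under eq_bigr do rewrite eqb.
case: ifPn => lS.
  rewrite (bigD1_seq l) ?stencil_uniq //= eqxx mulr1 big1 ?addr0 // => k.
  by move=> /negPf ->; rewrite mulr0.
rewrite big_seq big1 ?horner0 // => k kS; case: eqP => [kl|]; last first.
  by rewrite mulr0.
by rewrite -kl kS in lS.
Qed.

(** * The weight-functions solve the representation problem *)

Lemma sigmaR1_1_left Mm Mp :
  sigmaR1_1 R Mm Mp 0 = (alphaR1 R Mm Mp (- Mm))%:F
                        / (alphaR1 R Mm (Mp - 1) (- Mm))%:F.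
Proof. by rewrite /sigmaR1_1; congr (_%:F / _%:F); congr (alphaR1 _ _ _ _); lia. Qed.

Lemma sigmaR1_1_right Mm Mp :
  sigmaR1_1 R Mm Mp 1 = (alphaR1 R Mm Mp Mp)%:F
                        / (alphaR1 R (Mm - 1) Mp Mp)%:F.
Proof. by rewrite /sigmaR1_1; congr (_%:F / _%:F); congr (alphaR1 _ _ _ _); lia. Qed.

(* With [W0], [W1] the reconstructed node polynomials of the two substencils,
   the weight-functions are [W1 / (W1 - W0)] and [W0 / (W0 - W1)]. *)
Lemma sigmaR1_1_rep Mm Mp l : 1 <= Mm + Mp ->
  (alphaR1_ext Mm Mp l)%:F
  = sigmaR1_1 R Mm Mp 0 * (alphaR1_ext Mm (Mp - 1) l)%:F
    + sigmaR1_1 R Mm Mp 1 * (alphaR1_ext (Mm - 1) Mp l)%:F.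
Proof.
move=> M1; pose n := (absz (Mm + Mp)%R).+1.
pose W0 := reconstruct n (node R (stencil Mm (Mp - 1))).
pose W1 := reconstruct n (node R (stencil (Mm - 1) Mp)).
pose d l := lag_weight R (stencil Mm Mp) l.
have E0 j : j \in stencil Mm Mp ->
    alphaR1_ext Mm Mp j - alphaR1_ext Mm (Mp - 1) j = d j *: W0.
  move=> jS; rewrite !(@alphaR1_extE _ _ _ n) ?/n; try lia.
  have p := stencil_addr M1.
  rewrite -reconstructB (perm_lag_ext R _ p) lag_ext_cons ?reconstructZ.
  - by rewrite -(perm_lag_weight R _ p).
  - by rewrite -(perm_uniq p) stencil_uniq.
  - by rewrite -(perm_mem p).
have E1 j : j \in stencil Mm Mp ->
    alphaR1_ext Mm Mp j - alphaR1_ext (Mm - 1) Mp j = d j *: W1.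
  move=> jS; rewrite !(@alphaR1_extE _ _ _ n) ?/n; try lia.
  have p := stencil_addl M1.
  rewrite -reconstructB (perm_lag_ext R _ p) lag_ext_cons ?reconstructZ.
  - by rewrite -(perm_lag_weight R _ p).
  - by rewrite -(perm_uniq p) stencil_uniq.
  - by rewrite -(perm_mem p).
(* Reconstruction is linear and sends nonzero polynomials to nonzero ones, so distinct node
   polynomials stay distinct. *)
have W01 : W0%:F - W1%:F != 0.
  rewrite -tofracB tofrac_eq0 -reconstructB reconstruct_neq0 // subr_eq0.
  exact: node_stencil_neq.
have dF j : (d j)%:P%:F != 0 by rewrite tofrac_eq0 polyC_eq0 lag_weight_neq0.
(* The point [- Mm] is missing from the right substencil: there [E1] gives the numerator, [E1] and
   [E0] together the denominator, and [d (- Mm)] cancels. *)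
have s0 : sigmaR1_1 R Mm Mp 0 = W1%:F / (W1%:F - W0%:F).
  have h : - Mm \in stencil Mm Mp by rewrite mem_stencil; lia.
  have := E1 _ h; have := E0 _ h.
  rewrite /alphaR1_ext h !mem_stencil; try lia.
  rewrite (_ : (- Mm <= - Mm <= Mp - 1) = true); last by lia.
  rewrite (_ : (- (Mm - 1) <= - Mm <= Mp) = false); last by lia.
  rewrite subr0 sigmaR1_1_left => e0 e1.
  have -> : alphaR1 R Mm (Mp - 1) (- Mm) = d (- Mm) *: (W1 - W0).
    by rewrite scalerBr -e0 -e1 subKr.
  rewrite e1 -!mul_polyC 2!tofracM tofracB; apply: divf_mul2l; exact: dF.
(* Symmetrically, [Mp] is missing from the left substencil. *)
have s1 : sigmaR1_1 R Mm Mp 1 = W0%:F / (W0%:F - W1%:F).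
  have h : Mp \in stencil Mm Mp by rewrite mem_stencil; lia.
  have := E1 _ h; have := E0 _ h.
  rewrite /alphaR1_ext h !mem_stencil; try lia.
  rewrite (_ : (- Mm <= Mp <= Mp - 1) = false); last by lia.
  rewrite (_ : (- (Mm - 1) <= Mp <= Mp) = true); last by lia.
  rewrite subr0 sigmaR1_1_right => e0 e1.
  have -> : alphaR1 R (Mm - 1) Mp Mp = d Mp *: (W0 - W1).
    by rewrite scalerBr -e0 -e1 subKr.
  rewrite e0 -!mul_polyC 2!tofracM tofracB; apply: divf_mul2l; exact: dF.
have [lS|lS] := boolP (l \in stencil Mm Mp); last first.
  have z : [/\ alphaR1_ext Mm Mp l = 0, alphaR1_ext Mm (Mp - 1) l = 0
           & alphaR1_ext (Mm - 1) Mp l = 0].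
    move: lS; rewrite /alphaR1_ext !mem_stencil; try lia.
    by move=> lS; split; rewrite ifF //; lia.
  by case: z => -> -> ->; rewrite tofrac0 !mulr0 addr0.
have -> : alphaR1_ext Mm (Mp - 1) l = alphaR1_ext Mm Mp l - d l *: W0.
  by rewrite -E0 // subKr.
have -> : alphaR1_ext (Mm - 1) Mp l = alphaR1_ext Mm Mp l - d l *: W1.
  by rewrite -E1 // subKr.
rewrite s0 s1 -!mul_polyC !tofracB !tofracM.
exact: affine_combination.
Qed.

(** Each substencil [j] of one level splits into substencils [j] and [j + 1] of the next; collecting
    the products by target substencil gives the recursion. *)
Lemma sigmaR1_rep Mm Mp K l : (0 < K)%N -> K%:Z <= Mm + Mp ->
  (alphaR1_ext Mm Mp l)%:F
  = \sum_(k < K.+1) sigmaR1 R Mm Mp K k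
      * (alphaR1_ext (Mm - k%:Z) (Mp - K%:Z + k%:Z) l)%:F.
Proof.
elim: K => // -[_ _ M1|K IH _ KM].
  rewrite sigmaR1_1_rep // !big_ord_recl big_ord0 /= addr0 subr0 addr0.
  by rewrite subrK.
rewrite IH //; last by lia.
have sE k : sigmaR1 R Mm Mp K.+2 k = \sum_(k.-1 <= j < (minn K.+1 k).+1)
    sigmaR1 R Mm Mp K.+1 j
    * sigmaR1_1 R (Mm - j%:Z) (Mp - K.+1%:Z + j%:Z) (k - j) by [].
under [RHS]eq_bigr do rewrite sE.
move: (sigmaR1 R Mm Mp K.+1) => sg {sE}.
move: K.+1 KM => K1 KM.
(* The contribution that reaches substencil [k] through substencil [j] of the previous level. *)
pose G (j k : nat) := sg j
     * sigmaR1_1 R (Mm - j%:Z) (Mp - K1%:Z + j%:Z) (k - j)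
     * (alphaR1_ext (Mm - k%:Z) (Mp - K1.+1%:Z + k%:Z) l)%:F.
transitivity (\sum_(k < K1.+2) \sum_(j < K1.+1 | (k.-1 <= j <= k)%N) G j k).
  (* For fixed [j], the condition [k.-1 <= j <= k] leaves exactly [k = j] and [k = j + 1], also at
     [j = 0] despite the truncated predecessor. *)
  rewrite (exchange_big_dep predT) //=; apply: eq_bigr => j _.
  have jK := ltn_ord j.
  rewrite (bigD1 (widen_ord (leqnSn _) j)) /=; last by lia.
  rewrite (bigD1 (lift ord0 j)) /=; last first.
    by rewrite -val_eqE /= /bump /=; lia.
  rewrite big1 => [|k]; last first.
    by rewrite -!val_eqE /= /bump /=; lia.
  rewrite addr0 sigmaR1_1_rep /G; last by lia.
  rewrite mulrDr !mulrA /bump /= subnn add1n subSnn.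
  by congr (_ * (alphaR1_ext _ _ _)%:F + _ * (alphaR1_ext _ _ _)%:F); lia.
apply: eq_bigr => k _; rewrite mulr_suml.
rewrite [RHS](big_nat_widen _ _ K1.+1); last by rewrite ltnS geq_minl.
rewrite (big_nat_widenl _ 0) // big_mkord; apply: eq_bigl => j.
by have := ltn_ord j; lia.
Qed.

(** The point [k - Mm] is the left end of substencil [k], hence absent from all later ones; the
    earlier coefficients vanish by strong induction. *)
Lemma alphaR1_triangular Mm Mp K (t : 'I_K.+1 -> {fraction {poly R}}) :
    K%:Z <= Mm + Mp ->
    (forall l, \sum_(k < K.+1)
       t k * (alphaR1_ext (Mm - k%:Z) (Mp - K%:Z + k%:Z) l)%:F = 0) ->
  forall k, t k = 0.
Proof.
move=> KM h k; have [n] := ubnP (k : nat).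
elim: n k => // n IH k kn; have kK := ltn_ord k.
have := h (k%:Z - Mm); rewrite (bigD1 k) //= big1 => [|j]; last first.
  rewrite -val_eqE /= => jk; have jK := ltn_ord j.
  have [lt|gt] : (j < k)%N \/ (k < j)%N by lia.
    by rewrite IH ?mul0r //; lia.
  rewrite /alphaR1_ext mem_stencil; last by lia.
  by rewrite ifF ?tofrac0 ?mulr0 //; lia.
have kS : k%:Z - Mm \in stencil (Mm - k%:Z) (Mp - K%:Z + k%:Z).
  by rewrite mem_stencil; lia.
rewrite addr0 /alphaR1_ext kS => /eqP; rewrite mulf_eq0 tofrac_eq0.
by rewrite (negPf (alphaR1_neq0 _ kS)) ?orbF => [/eqP|]; [|lia].
Qed.

End Stencil.

(** * Rational functions determined by their values *)

Section RationalIdentities.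
Variable F : numFieldType.
Implicit Types (p q d : {poly F}) (s t : {fraction {poly F}}) (x v w : F).

Lemma poly_natroots_eq0 p : (forall n : nat, root p n%:R) -> p = 0.
Proof.
move=> h; apply: (@roots_geq_poly_eq0 _ p [seq n%:R | n <- iota 0 (size p)]).
- by apply/allP => x /mapP[n _ ->].
- by rewrite map_inj_uniq ?iota_uniq // => m n /eqP; rewrite eqr_nat => /eqP.
- by rewrite size_map size_iota.
Qed.

(** A relation that accepts any fraction regular at [x], so that sums and products need no reduction
    to lowest terms. *)
Definition has_value s x (v : F) : Prop :=
  exists p q, [/\ q.[x] != 0, s = p%:F / q%:F & v = p.[x] / q.[x]].

Lemma has_value_poly p x : has_value p%:F x p.[x].
Proof. by exists p, 1; rewrite hornerC oner_neq0 tofrac1 !divr1. Qed.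

Lemma has_value_eval s x : rf_defined s x -> has_value s x (rf_eval s x).
Proof.
by move=> sx; exists (rf_num s), (rf_den s); split; last by []; [|exact: rf_numden].
Qed.

Lemma has_valueD s t x v w :
  has_value s x v -> has_value t x w -> has_value (s + t) x (v + w).
Proof.
have nz q : q.[x] != 0 -> q%:F != 0.
  by rewrite tofrac_eq0; apply: contraNneq => ->; rewrite horner0.
move=> [p [q [qx -> ->]]] [p' [q' [qx' -> ->]]].
exists (p * q' + p' * q), (q * q'); rewrite hornerM mulf_neq0 //.
by rewrite !addf_div ?nz // tofracD !tofracM hornerD !hornerM.
Qed.

Lemma has_valueM s t x v w :
  has_value s x v -> has_value t x w -> has_value (s * t) x (v * w).
Proof.
move=> [p [q [qx -> ->]]] [p' [q' [qx' -> ->]]].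
by exists (p * p'), (q * q'); rewrite hornerM mulf_neq0 // !mulf_div !tofracM !hornerM.
Qed.

Lemma has_valueB s t x v w :
  has_value s x v -> has_value t x w -> has_value (s - t) x (v - w).
Proof.
move=> hs ht; rewrite -mulN1r -[- w]mulN1r; apply: has_valueD => //.
apply: has_valueM => //; have := has_value_poly (- 1)%:P x.
by rewrite hornerC polyCN tofracN tofrac1.
Qed.

Lemma has_value_sum n (u : 'I_n -> {fraction {poly F}}) x (v : 'I_n -> F) :
  (forall k, has_value (u k) x (v k)) ->
  has_value (\sum_k u k) x (\sum_k v k).
Proof.
move=> h; elim/big_ind2: _ => [|s v1 t v2|k _]; [|exact: has_valueD|exact: h].
by rewrite -tofrac0 -(horner0 x); exact: has_value_poly.
Qed.

Lemma has_value0_eq0 t d : d != 0 ->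
  (forall x, ~~ root d x -> has_value t x 0) -> t = 0.
Proof.
move=> d0 h; have : rf_num t * d = 0.
  (* At each natural number either [d] vanishes or the value 0 forces the reduced numerator to
     vanish, by cross-multiplication. *)
  apply: poly_natroots_eq0 => n; rewrite rootM orbC -implyNb; apply/implyP.
  move=> /h[p [q [qx tE /esym/eqP]]].
  rewrite mulf_eq0 invr_eq0 (negPf qx) orbF => /eqP px.
  have q0 : q != 0 by apply: contraNneq qx => ->; rewrite horner0.
  have /(congr1 (horner^~ n%:R)) := rf_cross q0 tE.
  by rewrite !hornerM px mul0r => /eqP; rewrite mulf_eq0 (negPf qx) orbF.
move/eqP; rewrite mulf_eq0 (negPf d0) orbF => /eqP num0.
by rewrite [t]rf_numden num0 tofrac0 mul0r.
Qed.

End RationalIdentities.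

(** * Finiteness of the exceptional set, and uniqueness *)

Lemma poleset_finite (R : realType) Mm Mp K : 1 <= Mm + Mp ->
  exists2 d : {poly R}, d != 0 & forall x, ~~ root d x -> x \notin poleset Mm Mp K.
Proof.
move=> M1; rewrite /poleset; case: ifP => _.
  by exists (alphaR1 R (Mm - 1) Mp Mp) => //; rewrite alphaR1_neq0 ?mem_stencil; lia.
exists (\prod_(k < K.+1) rf_den (sigmaR1 R Mm Mp K k)).
  by apply/prodf_neq0 => k _; exact: rf_den_neq0.
move=> x; apply: contra; rewrite inE => /existsP[k]; rewrite negbK => kx.
by rewrite (bigD1 k) //= rootM kx.
Qed.

Theorem proposition4p7 (R : realType) (Mm Mp : int) (K : nat)
    (hM : 2 <= Mm + Mp)
    (hK1 : (1 <= K)%N) (hKM : K%:Z <= Mm + Mp - 1)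
    (s : 'I_K.+1 -> {fraction {poly R}})
    (hs : forall xi : R,
        xi \notin poleset Mm Mp K ->
        (forall k : 'I_K.+1, rf_defined (s k) xi) ->
        forall (x_i dx : R), 0 < dx -> forall f : R -> R,
          pR1 Mm Mp (x_i + xi * dx) x_i dx f =
          \sum_(k < K.+1)
            rf_eval (s k) xi
            * pR1 (Mm - k%:Z) (Mp - K%:Z + k%:Z) (x_i + xi * dx) x_i dx f) :
  forall k : 'I_K.+1, s k = sigmaR1 R Mm Mp K k.
Proof.
have M1 : 1 <= Mm + Mp by lia.
have rep l : (alphaR1_ext R Mm Mp l)%:F
    = \sum_(k < K.+1) s k * (alphaR1_ext R (Mm - k%:Z) (Mp - K%:Z + k%:Z) l)%:F.
  apply/eqP; rewrite -subr_eq0; apply/eqP.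
  have [d d0 hd] := poleset_finite R K M1.
  (* Off the roots of this product, the point avoids both the pole set and the poles of all [s k],
     so the hypothesis applies. *)
  apply: (@has_value0_eq0 _ _ (d * \prod_(k < K.+1) rf_den (s k))).
    by rewrite mulf_neq0 //; apply/prodf_neq0 => k _; exact: rf_den_neq0.
  move=> x; rewrite rootM negb_or => /andP[/hd xS dx].
  have sx k : rf_defined (s k) x.
    by move: dx; apply: contra => rx; rewrite (bigD1 k) //= rootM rx.
  have := hs x xS sx 0 1 ltr01 (fun y => (y == l%:~R)%:R).
  rewrite pR1_indicator; under eq_bigr do rewrite pR1_indicator.
  move=> e; rewrite -(subrr (alphaR1_ext R Mm Mp l).[x]) {2}e.
  apply: has_valueB; first exact: has_value_poly.
  apply: has_value_sum => k; apply: has_valueM; last exact: has_value_poly.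
  exact: has_value_eval.
(* The difference of the two solutions solves the homogeneous triangular system. *)
move=> k; apply/eqP; rewrite -subr_eq0; apply/eqP; move: k.
apply: (@alphaR1_triangular _ Mm Mp K); first by lia.
move=> l; under eq_bigr do rewrite mulrBl.
by rewrite sumrB -rep -sigmaR1_rep ?subrr //; lia.
Qed.
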